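(* Let $R$ be a commutative ring and let $A=R\times R$ with the involution $(x,y)^*=(y,x)$. Then $\Gamma'(A)$ is connected if and only if $R$ is not an integral domain.
   Context: For a ring $A$ with involution $*$, $Z^*(A)$ denotes the set of all non-zero zero-divisors of $A$. The generalized zero-divisor graph $\Gamma'(A)$ is the simple undirected graph with vertex set $Z^*(A)$ in which two distinct vertices $u,v$ are adjacent if and only if $u^nv^*=0$ or $v^nu^*=0$ for some positive integer $n$. *)

(* Defs.v *)
From HB Require Import structures.
From mathcomp Require Import all_boot all_order all_algebra.
From Stdlib Require Import Relation_Operators.

Set Implicit Arguments.
Unset Strict Implicit.
Unset Printing Implicit Defensive.

Import GRing.Theory.
Local Open Scope ring_scope.

(* [pzRingType] and [comPzRingType] are the (commutative) unital rings in which
   1 = 0 is allowed; the zero ring is thus a commutative ring, and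
   [integral_domain] excludes it. *)
Definition integral_domain (R : comPzRingType) : Prop :=
  1 != 0 :> R /\ GRing.integral_domain_axiom R.

Record involution (A : pzRingType) := Involution {
  star :> A -> A;
  starD : {morph star : x y / x + y >-> x + y};
  starM : forall x y, star (x * y) = star y * star x;
  starK : involutive star
}.

Record sgraph := SGraph {
  vertex :> Type;
  adj : vertex -> vertex -> Prop;
  adj_sym : forall u v, adj u v -> adj v u;
  adj_irrefl : forall u, ~ adj u u
}.

(* [clos_refl_trans] is reachability along a finite, possibly empty, walk.  The
   graph without vertices is connected in this sense. *)
Definition connected_graph (G : sgraph) : Prop :=
  forall u v : G, clos_refl_trans G (@adj G) u v.

Section GeneralizedZeroDivisorGraph.
Variables (A : pzRingType) (s : involution A).

Definition left_zero_divisor (u : A) : Prop :=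
  exists2 v : A, v != 0 & u * v = 0.

Definition right_zero_divisor (u : A) : Prop :=
  exists2 v : A, v != 0 & v * u = 0.

Definition nonzero_zero_divisor (u : A) : Prop :=
  u != 0 /\ (left_zero_divisor u \/ right_zero_divisor u).

Definition gzd_vertex : Type := {u : A | nonzero_zero_divisor u}.

(* Distinctness is that of the underlying ring elements, so it does not depend
   on the membership proofs. *)
Definition gzd_adj (u v : gzd_vertex) : Prop :=
  sval u != sval v /\
  exists2 n : nat, (0 < n)%N &
    sval u ^+ n * s (sval v) = 0 \/ sval v ^+ n * s (sval u) = 0.

Fact gzd_adj_sym u v : gzd_adj u v -> gzd_adj v u.
Proof.
by case=> neq_uv [n n_gt0 uv0]; split; [rewrite eq_sym | exists n; tauto].
Qed.

Fact gzd_adj_irrefl u : ~ gzd_adj u u.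
Proof. by case; rewrite eqxx. Qed.

Definition gzd_graph : sgraph := SGraph gzd_adj_sym gzd_adj_irrefl.

End GeneralizedZeroDivisorGraph.

Section SwapInvolution.
Variable R : comPzRingType.

Definition swap (p : R * R) : R * R := (p.2, p.1).

Fact swapD : {morph swap : p q / p + q >-> p + q}.
Proof. by []. Qed.

Fact swapM (p q : R * R) : swap (p * q) = swap q * swap p.
Proof. by congr (_, _); rewrite mulrC. Qed.

Fact swapK : involutive swap.
Proof. by case. Qed.

Definition swap_involution : involution (R * R)%type :=
  Involution swapD swapM swapK.

End SwapInvolution.

(* Main.v *)
Require Import Defs.
From mathcomp Require Import all_boot all_order all_algebra.
From Stdlib Require Import Relation_Operators Classical.

(** In an integral domain the vertices are the pairs [(a, 0)] and [(0, b)] with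
    nonzero entries, and adjacency preserves the vanishing of the first entry.
    If [R] is nonzero and [a * b = 0] with [a, b != 0], every vertex is equal or
    adjacent to some [(a', 0)] or [(0, b')], the vertices of each of these two
    kinds form a clique, and [(a, 0)] is adjacent to [(0, b)]. *)

Set Implicit Arguments.
Unset Strict Implicit.
Unset Printing Implicit Defensive.

Import GRing.Theory.
Local Open Scope ring_scope.

Section SwapGraph.
Variable R : comPzRingType.
Local Notation G := (gzd_graph (swap_involution R)).
Local Notation reach := (clos_refl_trans G (@adj G)).

Lemma zero_divisor_fst (a : R) :
  a != 0 -> nonzero_zero_divisor ((a, 0) : (R * R)%type).
Proof.
move=> a0; split; first by apply: contra_neq a0 => -[].
left; exists (0, a); first by apply: contra_neq a0 => -[].
by congr (_, _); rewrite /= ?mulr0 ?mul0r.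
Qed.

Lemma zero_divisor_snd (b : R) :
  b != 0 -> nonzero_zero_divisor ((0, b) : (R * R)%type).
Proof.
move=> b0; split; first by apply: contra_neq b0 => -[].
left; exists (b, 0); first by apply: contra_neq b0 => -[].
by congr (_, _); rewrite /= ?mulr0 ?mul0r.
Qed.

Definition vfst (a : R) (a0 : a != 0) : G := exist _ _ (zero_divisor_fst a0).
Definition vsnd (b : R) (b0 : b != 0) : G := exist _ _ (zero_divisor_snd b0).

Lemma reach_sym (u v : G) : reach u v -> reach v u.
Proof.
elim=> [x y xy|x|x y z _ yx _ zy]; first by apply/rt_step/adj_sym.
  exact: rt_refl.
exact: rt_trans zy yx.
Qed.

(** Reachability absorbs the distinctness condition: distinct elements give an edge with exponent 1,
    equal ones the empty walk. *)
Lemma reach_mul0 (u v : G) : sval u * swap (sval v) = 0 -> reach u v.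
Proof.
case: (eqVneq (sval u) (sval v)) => [|neq_uv uv0].
  case: u v => [u Hu] [v Hv] /= uv; case: v / uv Hv => Hv _.
  (* Vertices over the same ring element can differ only in their membership proofs. *)
  by rewrite (proof_irrelevance _ Hu Hv); apply: rt_refl.
by apply: rt_step; split=> //; exists 1%N => //; left; rewrite expr1.
Qed.

Lemma reach_vfst (a b : R) (a0 : a != 0) (b0 : b != 0) :
  reach (vfst a0) (vfst b0).
Proof. by apply: reach_mul0; congr (_, _); rewrite /= ?mulr0 ?mul0r. Qed.

Lemma reach_vsnd (a b : R) (a0 : a != 0) (b0 : b != 0) :
  reach (vsnd a0) (vsnd b0).
Proof. by apply: reach_mul0; congr (_, _); rewrite /= ?mulr0 ?mul0r. Qed.

Lemma reach_vfst_vsnd (a b : R) (a0 : a != 0) (b0 : b != 0) :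
  a * b = 0 -> reach (vfst a0) (vsnd b0).
Proof. by move=> ab0; apply: reach_mul0; congr (_, _); rewrite /= ?mulr0. Qed.

(** A nonzero [v] with [u * v = 0] has a nonzero entry. Moving that entry to the other coordinate
    and putting 0 in its place gives the required vertex, since [swap] moves the entry back against
    the coordinate of [u] that it kills. *)
Lemma reach_axis (u : G) :
  (exists a (a0 : a != 0), reach u (vfst a0)) \/
  (exists b (b0 : b != 0), reach u (vsnd b0)).
Proof.
have [v v0 uv0] : left_zero_divisor (sval u).
  by case: (proj2 (svalP u)) => // -[v v0 vu0]; exists v => //; rewrite mulrC.
have [u1v1 u2v2] : (sval u).1 * v.1 = 0 /\ (sval u).2 * v.2 = 0.
  by case: uv0.
case: (eqVneq v.1 0) => [v10|v10]; last first.
  right; exists v.1, v10; apply: reach_mul0.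
  by congr (_, _); rewrite /= ?mulr0.
case: (eqVneq v.2 0) => [v20|v20].
  by case/eqP: v0; case: v v10 v20 {uv0 u1v1 u2v2} => /= ? ? -> ->.
left; exists v.2, v20; apply: reach_mul0.
by congr (_, _); rewrite /= ?mulr0.
Qed.

Lemma zero_divisors_connected (a b : R) :
  a != 0 -> b != 0 -> a * b = 0 -> connected_graph G.
Proof.
move=> a0 b0 ab0.
(* The vertex [(a, 0)] serves as a hub; a vertex sent to some [(0, c)] gets there through
   [(0, b)]. *)
have hub (u : G) : reach u (vfst a0).
  case: (reach_axis u) => -[c [c0 uc]]; apply: rt_trans uc _.
    exact: reach_vfst.
  apply: rt_trans (reach_vsnd c0 b0) _.
  exact/reach_sym/reach_vfst_vsnd.
by move=> u v; apply: rt_trans (hub u) (reach_sym (hub v)).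
Qed.

Lemma domain_expM_eq0 (x y : R) n : GRing.integral_domain_axiom R ->
  x ^+ n * y = 0 -> x = 0 \/ y = 0.
Proof.
move=> dom; elim: n => [|n IHn]; first by rewrite expr0 mul1r; right.
by rewrite exprS -mulrA => /dom/orP[/eqP|/eqP/IHn //]; left.
Qed.

Lemma expr_fst (p : R * R) n : (p ^+ n).1 = p.1 ^+ n.
Proof. by elim: n => // n IHn; rewrite !exprS /= IHn. Qed.

Lemma expr_snd (p : R * R) n : (p ^+ n).2 = p.2 ^+ n.
Proof. by elim: n => // n IHn; rewrite !exprS /= IHn. Qed.

(** Induction on the walk. Along an edge from [u = (0, y)] with [y] nonzero, one coordinate of the
    adjacency equation is a product of powers of [y] and of the first entry of [v], so that entry
    vanishes. *)
Lemma domain_reach_fst (u v : G) : GRing.integral_domain_axiom R ->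
  reach u v -> (sval u).1 = 0 -> (sval v).1 = 0.
Proof.
move=> dom; elim=> [{}u {}v [_ [n _ uv0]]|//|x y z _ xy _ yz /xy/yz //] u10.
have u20 : (sval u).2 <> 0.
  move=> u20; case/negP: (proj1 (svalP u)).
  by rewrite [sval u]surjective_pairing u10 u20.
case: uv0 => [/(congr1 snd)|/(congr1 fst)] /=.
  by rewrite expr_snd => /(domain_expM_eq0 dom)[].
by rewrite expr_fst => /(domain_expM_eq0 dom)[].
Qed.

End SwapGraph.

Theorem proposition3p5 (R : comPzRingType) :
  connected_graph (gzd_graph (swap_involution R)) <-> ~ integral_domain R.
Proof.
split=> [conn [R10 dom]|ndom].
  (* A walk from [(0, 1)] to [(1, 0)] would force [1 = 0]. *)
  have := domain_reach_fst dom (conn (vsnd R10) (vfst R10)) erefl.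
  by move/eqP; apply/negP.
case: (eqVneq (1 : R) 0) => [R10|R10].
  (* Over the zero ring every pair is 0, so the graph has no vertices. *)
  move=> u; case/negP: (proj1 (svalP u)).
  by rewrite -(mul1r (sval u)) (_ : 1 = 0) ?mul0r ?eqxx //; congr (_, _).
have [[a [b [a0 b0 ab0]]]|nab] :=
  classic (exists a b : R, [/\ a != 0, b != 0 & a * b = 0]).
  exact: zero_divisors_connected a0 b0 ab0.
case: ndom; split=> // a b ab0; apply: contra_notT nab.
by rewrite negb_or => /andP[a0 b0]; exists a, b.
Qed.
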